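(* Let $X$ be a completely regular topological space and let $\alpha\subseteq\kappa(X)$ be a collection of compact families which is stable under finite intersections and such that every open subset of $X$ belongs to some member of $\alpha$. Then $\alpha$ is self-joinable if and only if $$\mathcal{N}_\alpha(\overline{0})+\mathcal{N}_\alpha(\overline{0})\geq \mathcal{N}_\alpha(\overline{0}),$$ that is, addition $C_\alpha(X,\mathbb{R})\times C_\alpha(X,\mathbb{R})\to C_\alpha(X,\mathbb{R})$ is jointly continuous at $(\overline{0},\overline{0})$.
   Context: Let $\mathcal{O}_X$ be the set of open subsets of $X$. For a family $\mathcal{A}$ of subsets of $X$, $\mathcal{O}_X(\mathcal{A})$ is the family of open subsets of $X$ containing an element of $\mathcal{A}$. A compact family on $X$ is a nonempty $\mathcal{A}\subseteq\mathcal{O}_X$ with $\mathcal{O}_X(\mathcal{A})=\mathcal{A}$ such that whenever $\mathcal{P}\subseteq\mathcal{O}_X$ and $\bigcup\mathcal{P}\in\mathcal{A}$, there is a finite $\mathcal{P}_0\subseteq\mathcal{P}$ with $\bigcup\mathcal{P}_0\in\mathcal{A}$ (the family $\mathcal{O}_X$ itself is allowed). $\kappa(X)$ is the set of all compact families on $X$. For a collection $\alpha\subseteq\kappa(X)$ such that every open subset of $X$ belongs to some member of $\alpha$, $C_\alpha(X,\mathbb{R})$ is the set $C(X,\mathbb{R})$ of continuous functions $X\to\mathbb{R}$ with the topology having as subbase of open sets the sets $[\mathcal{A},U]=\{f\in C(X,\mathbb{R}): f^{-1}(U)\in\mathcal{A}\}$, for $\mathcal{A}\in\alpha$ and $U\subseteq\mathbb{R}$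 open. $\overline{0}$ is the zero function and $\mathcal{N}_\alpha(\overline{0})$ its neighborhood filter in $C_\alpha(X,\mathbb{R})$. The inequality $\mathcal{N}_\alpha(\overline{0})+\mathcal{N}_\alpha(\overline{0})\geq\mathcal{N}_\alpha(\overline{0})$ means: for every $V\in\mathcal{N}_\alpha(\overline{0})$ there is $W\in\mathcal{N}_\alpha(\overline{0})$ with $W+W\subseteq V$. A collection $\alpha\subseteq\kappa(X)$ is self-joinable if for every $\mathcal{A}\in\alpha$ there is $\mathcal{G}\in\alpha$ with $\mathcal{G}\vee\mathcal{G}\subseteq\mathcal{A}$, where $\mathcal{G}\vee\mathcal{G}=\{G_1\cap G_2: G_1,G_2\in\mathcal{G}\}$. *)

(* Defs.v *)
From HB Require Import structures.
From mathcomp Require Import all_boot all_order all_algebra.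
From mathcomp Require Import all_classical all_reals all_analysis.

Set Implicit Arguments.
Unset Strict Implicit.
Unset Printing Implicit Defensive.

Import Order.TTheory GRing.Theory Num.Theory.
Import numFieldNormedType.Exports.

Local Open Scope classical_set_scope.
Local Open Scope ring_scope.

Section CompactFamilies.
Context {X : topologicalType}.
Implicit Types (A G : set (set X)) (alpha : set (set (set X))).

Definition open_supersets A : set (set X) :=
  [set U | open U /\ exists2 B, A B & B `<=` U].

(* The elements of [compact_family] form the collection kappa(X). *)
Definition compact_family : set (set (set X)) := [set A |
  [/\ A !=set0,
      A `<=` open,
      open_supersets A = A
    & forall P : set (set X), P `<=` open -> A (\bigcup_(U in P) U) ->
        exists P0 : set (set X),
          [/\ P0 `<=` P, finite_set P0 & A (\bigcup_(U in P0) U)]]].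

Definition join_family A G : set (set X) :=
  [set U `&` V | U in A & V in G].

Definition self_joinable alpha : Prop :=
  forall A, alpha A -> exists2 G, alpha G & join_family G G `<=` A.

End CompactFamilies.

Section ContinuousGroup.
Context {X : topologicalType} {R : realType}.
Local Notation CXR := (continuousType X R).
Implicit Types f g h : CXR.

Let ctsD f g : continuous (fun x => f x + g x).
Proof. by move=> x; apply: cvgD; exact: cts_fun. Qed.

Let ctsN f : continuous (fun x => - f x).
Proof. by move=> x; apply: cvgN; exact: cts_fun. Qed.

Definition cts_zero : CXR := cst 0.
Definition cts_add f g : CXR := mkcts (@ctsD f g).
Definition cts_opp f : CXR := mkcts (@ctsN f).

Let cts_addA : associative cts_add.
Proof. by move=> f g h; apply/continuousEP => x; exact: addrA. Qed.

Let cts_addC : commutative cts_add.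
Proof. by move=> f g; apply/continuousEP => x; exact: addrC. Qed.

Let cts_add0 : left_id cts_zero cts_add.
Proof. by move=> f; apply/continuousEP => x; exact: add0r. Qed.

Let cts_addN : left_inverse cts_zero cts_opp cts_add.
Proof. by move=> f; apply/continuousEP => x; exact: addNr. Qed.

HB.instance Definition _ :=
  GRing.isZmodule.Build CXR cts_addA cts_addC cts_add0 cts_addN.

End ContinuousGroup.

(* [continuousType X R] already carries a topology in some contexts, hence the
   alias; [alpha] is a phantom parameter that selects the topology. *)
Definition Calpha {X : topologicalType} (R : realType)
  (alpha : set (set (set X))) : Type := continuousType X R.

Section CalphaTopology.
Context {X : topologicalType} (R : realType) (alpha : set (set (set X))).

HB.instance Definition _ :=
  GRing.Zmodule.copy (Calpha R alpha) (continuousType X R).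

Definition Calpha_subbase (AU : set (set X) * set R) : set (Calpha R alpha) :=
  [set f : continuousType X R | AU.1 (f @^-1` AU.2)].

HB.instance Definition _ := isSubBaseTopological.Build (Calpha R alpha)
  (alpha `*` (@open R)) Calpha_subbase.

(* N_alpha(0) + N_alpha(0) >= N_alpha(0) *)
Definition nbhs0_add_ge : Prop :=
  forall V : set (Calpha R alpha), nbhs 0 V ->
    exists2 W : set (Calpha R alpha),
      nbhs 0 W & [set f + g | f in W & g in W] `<=` V.

Definition Calpha_add (fg : Calpha R alpha * Calpha R alpha) : Calpha R alpha :=
  fg.1 + fg.2.

End CalphaTopology.

(* Main.v *)
Require Import Defs.
From mathcomp Require Import all_boot all_order all_algebra.
From mathcomp Require Import all_classical all_reals all_analysis.
From mathcomp Require Import finmap lra.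

Import Order.TTheory GRing.Theory Num.Theory numFieldNormedType.Exports.

Local Open Scope classical_set_scope.
Local Open Scope ring_scope.

(** Since [alpha] is stable under intersection, the zero function has a
    neighbourhood base made of the sets [subbase_ball A e] of the functions [f]
    with [f @^-1` ball 0 e] in [A], for [A] in [alpha] and [0 < e]
    ([nbhs0_subbase_ballP]).

    If [G] in [alpha] satisfies [join_family G G `<=` A], the sum of two
    functions of [subbase_ball G (e / 2)] is in [subbase_ball A e]
    ([subbase_ballD]), so that self-joinability gives the inequality of filters.

    Conversely, suppose that sums of two functions of [subbase_ball G e] are in
    [subbase_ball A 1], and let [U] and [V] be elements of [G]. Complete
    regularity covers [U] by open sets on each of which some nonnegative
    continuous function vanishes while being at least [1] off [U]. By
    compactness of [G], a finite union of them is in [G], and the product of the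
    corresponding functions is a nonnegative function [f] that vanishes on an
    element of [G] and is at least [1] off [U] ([compact_family_separated]).
    Then [f] is in [subbase_ball G e] whatever [e]. With [g] obtained in the same
    way from [V], the set where [f + g] is of size less than [1] is in [A], and
    it is contained in [U `&` V], which is therefore in [A].

    The equivalence with continuity of addition at the origin only uses that
    neighbourhoods of a pair contain products of neighbourhoods, and that the
    neighbourhoods of zero form a filter. *)

(** * Compact families *)

Section CompactFamily.
Context {X : topologicalType}.
Implicit Types (A : set (set X)) (U V : set X).

Lemma compact_familyS A U V :
  compact_family A -> open V -> U `<=` V -> A U -> A V.
Proof. by move=> [_ _ Aup _] oV UV AU; rewrite -Aup; split=> //; exists U. Qed.

Lemma compact_familyT A : compact_family A -> A setT.
Proof.
by move=> cA; have [[U AU] _ _ _] := cA; exact: compact_familyS cA openT _ AU.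
Qed.

End CompactFamily.

(** * Functional separation from the complement of an open set *)

Section Separation.
Context (R : realType) {X : topologicalType}.
Implicit Types (G : set X) (A : set (set X)).

(** The open sets [V] functionally separated from the complement of [G]. The
    separating function is only required to be at least [1] off [G], rather
    than to have values in the unit interval. *)
Definition separated_opens G : set (set X) := [set V | open V /\
  exists h : X -> R, [/\ continuous h, forall x, 0 <= h x,
    forall x, V x -> h x = 0 & forall x, ~ G x -> 1 <= h x]].

Lemma separated_opens_sub G V : separated_opens G V -> V `<=` G.
Proof.
move=> [_ [h [_ _ hV hG]]] x Vx; apply: contrapT => /hG.
by rewrite hV// ler10.
Qed.

Lemma separated_opens0 G : separated_opens G set0.
Proof.
split; first exact: open0.
by exists (cst 1); split => // x; exact: cvg_cst.
Qed.

(** The product of two separating functions separates the union. *)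
Lemma separated_opensU G U V :
  separated_opens G U -> separated_opens G V -> separated_opens G (U `|` V).
Proof.
move=> [oU [h [hc h0 hU hG]]] [oV [k [kc k0 kV kG]]].
split; first exact: openU.
exists (fun x => h x * k x); split.
- by move=> x; apply: cvgM; [exact: hc|exact: kc].
- by move=> x; rewrite mulr_ge0.
- by move=> x [/hU|/kV] ->; rewrite ?mul0r ?mulr0.
- by move=> x nGx; rewrite -[1]mulr1 ler_pM ?hG ?kG.
Qed.

Lemma separated_opens_bigcup G (P : set (set X)) :
  finite_set P -> P `<=` separated_opens G ->
  separated_opens G (\bigcup_(U in P) U).
Proof.
move=> /finite_seqP[s ->] sP.
rewrite bigcup_seq; elim: s sP => [|U s IH] sP.
  by rewrite big_nil; exact: separated_opens0.
rewrite big_cons; apply: separated_opensU.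
  by apply: sP; rewrite /= mem_head.
by apply: IH => V Vs; apply: sP; rewrite /= in_cons Vs orbT.
Qed.

Lemma separated_opens_point G x :
  completely_regular_space X -> open G -> G x ->
  exists2 V, separated_opens G V & V x.
Proof.
move=> creg oG Gx.
have /(uniform_separatorP (R := R))[f [fc _ f0 f1]] :=
  creg x (~` G) (open_closedC oG) (fun nGx => nGx Gx).
have fx : f x = 0 by apply: f0; exists x.
exists (f @^-1` [set y | y < 2^-1]); last by rewrite /= fx invr_gt0.
split; first by apply: open_comp; [move=> ? _; exact: fc | exact: open_lt].
(* twice the positive part of 2 f - 1 *)
pose t y := 2 * f y - 1; exists (fun y => `|t y| + t y).
have tc : continuous t.
  by move=> y; apply: cvgB; [apply: cvgMr; exact: fc|exact: cvg_cst].
split.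
- by move=> y; apply: cvgD; [apply: cvg_norm|]; exact: tc.
- by move=> y; have := ler_norm (- t y); rewrite normrN; lra.
- move=> y /= fy; have ty : t y <= 0 by rewrite /t; lra.
  by rewrite ler0_norm ?addNr.
- move=> y nGy; have fy : f y = 1 by apply: f1; exists y.
  have -> : t y = 1 by rewrite /t fy; lra.
  by rewrite normr1; lra.
Qed.

(** The separated open sets cover [G] by complete regularity, so the union of
    finitely many of them is in [A] by compactness. *)
Lemma compact_family_separated A G :
  completely_regular_space X -> compact_family A -> A G ->
  exists2 V, A V & separated_opens G V.
Proof.
move=> creg cA AG; have [_ Aop _ Acpt] := cA.
have GE : \bigcup_(U in separated_opens G) U = G.
  apply/seteqP; split=> [x [U /separated_opens_sub + Ux]|x Gx]; first exact.
  have [V GV Vx] := separated_opens_point _ _ creg (Aop _ AG) Gx.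
  by exists V.
have [| |P [Psub Pfin AP]] := Acpt (separated_opens G).
- by move=> U [].
- by rewrite GE.
- by exists (\bigcup_(U in P) U) => //; exact: separated_opens_bigcup.
Qed.

End Separation.

(** * Neighbourhoods of the zero function *)

Section NeighborhoodsOfZero.
Context {X : topologicalType} (R : realType) (alpha : set (set (set X))).
Context (alpha_compact : alpha `<=` compact_family).
Implicit Types (A : set (set X)) (e : R) (f g : Calpha R alpha).

(** The subbasic open set of the functions [f] for which the preimage of the
    interval of radius [e] around [0] belongs to [A]. *)
Definition subbase_ball A e : set (Calpha R alpha) :=
  @Calpha_subbase X R alpha (A, ball (0 : R) e).

Lemma Calpha_subbase_open A (U : set R) :
  alpha A -> open U -> open (@Calpha_subbase X R alpha (A, U)).
Proof.
move=> aA oU; exists [set @Calpha_subbase X R alpha (A, U)]; last first.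
  by rewrite bigcup_set1.
by move=> _ ->; apply: (@finI_from1 _ _ _ _ (A, U)).
Qed.

Lemma Calpha_preimage_open f (U : set R) : open U -> open (f @^-1` U).
Proof.
by apply: open_comp => x _; exact: (@cts_fun _ _ (f : continuousType X R)).
Qed.

Lemma subbase_ball_nbhs A e : alpha A -> 0 < e -> nbhs 0 (subbase_ball A e).
Proof.
move=> aA e0; apply: open_nbhs_nbhs; split.
  by apply: Calpha_subbase_open => //; exact: ball_open.
have cA := alpha_compact _ aA.
apply: (compact_familyS _ setT _ cA _ _ (compact_familyT _ cA)).
  by apply: Calpha_preimage_open; exact: ball_open.
by move=> x _; exact: ballxx.
Qed.

Lemma subbase_ballS A B e d : alpha B -> A `<=` B -> e <= d ->
  subbase_ball A e `<=` subbase_ball B d.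
Proof.
move=> aB AB ed f Af.
apply: (compact_familyS _ _ _ (alpha_compact _ aB) _ _ (AB _ Af)).
  by apply: Calpha_preimage_open; exact: ball_open.
by move=> x; exact: le_ball.
Qed.

Context (alpha_setI : setI_closed alpha) (alpha0 : alpha !=set0).

(** A subbasic open set that contains the zero function without [0] lying in
    the prescribed open set [U] is the whole space: then the empty set belongs
    to [A]. *)
Lemma Calpha_subbase_ball A (U : set R) :
  alpha A -> open U -> @Calpha_subbase X R alpha (A, U) 0 ->
  exists2 e : R, 0 < e &
    subbase_ball A e `<=` @Calpha_subbase X R alpha (A, U).
Proof.
move=> aA oU A0; have cA := alpha_compact _ aA.
have [U0|nU0] := pselect (U 0).
  have /nbhs_ballP[e e0 eU] : nbhs 0 U by exact: open_nbhs_nbhs.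
  exists e => // f; apply: compact_familyS => //.
    exact: Calpha_preimage_open.
  by move=> x; exact: eU.
exists 1 => // f _; apply: (compact_familyS _ _ _ cA _ _ A0).
  exact: Calpha_preimage_open.
by move=> x /= /nU0.
Qed.

Lemma Calpha_subbase_seq_ball (s : seq (set (set X) * set R)) :
  (forall i, i \in s -> (alpha `*` open) i) ->
  (forall i, i \in s -> @Calpha_subbase X R alpha i 0) ->
  exists A, alpha A /\ exists2 e : R, 0 < e & forall f, subbase_ball A e f ->
    forall i, i \in s -> @Calpha_subbase X R alpha i f.
Proof.
elim: s => [_ _|[A U] s IH sD s0].
  by have [A aA] := alpha0; exists A; split=> //; exists 1.
have [||B [aB [e e0 BE]]] := IH.
- by move=> i si; apply: sD; rewrite in_cons si orbT.
- by move=> i si; apply: s0; rewrite in_cons si orbT.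
have [aA oU] := sD _ (mem_head _ _).
have [d d0 AdU] := Calpha_subbase_ball _ _ aA oU (s0 _ (mem_head _ _)).
exists (A `&` B); split; first exact: alpha_setI.
exists (Num.min d e); first by rewrite lt_min d0.
move=> f fAB i; rewrite in_cons => /predU1P[->|si].
  apply/AdU; apply: subbase_ballS fAB => //.
  by rewrite ge_min lexx.
apply: BE si; apply: subbase_ballS fAB => //.
by rewrite ge_min lexx orbT.
Qed.

Lemma nbhs0_subbase_ballP (V : set (Calpha R alpha)) :
  nbhs 0 V <->
  exists A, alpha A /\ exists2 e : R, 0 < e & subbase_ball A e `<=` V.
Proof.
split=> [|[A [aA [e e0 AeV]]]]; last first.
  by apply: filterS AeV _; exact: subbase_ball_nbhs.
rewrite nbhsE => -[_ [[D DI <-] [B DB B0]] DV].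
have [E ED EB] := DI _ DB; rewrite -EB in B0.
have [|A [aA [e e0 AeE]]] := Calpha_subbase_seq_ball (enum_fset E) _ B0.
  by move=> i /ED /set_mem.
exists A; split=> //; exists e => // f /AeE fE.
by apply: DV; exists B => //; rewrite -EB.
Qed.

(** The sum [f + g] is of size less than [e] wherever [f] and [g] are both of
    size less than [e / 2], that is, on an intersection of two elements of
    [G]. *)
Lemma subbase_ballD A G (e : R) f g : alpha A -> join_family G G `<=` A ->
  subbase_ball G (e / 2) f -> subbase_ball G (e / 2) g ->
  subbase_ball A e (f + g).
Proof.
move=> aA GA Gf Gg.
pose B := ball (0 : R) (e / 2).
have Afg : A (f @^-1` B `&` g @^-1` B).
  by apply: GA; exists (f @^-1` B) => //; exists (g @^-1` B).
apply: (compact_familyS _ _ _ (alpha_compact _ aA) _ _ Afg).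
  by apply: Calpha_preimage_open; exact: ball_open.
move=> x []; rewrite /B /= -!ball_normE /= !sub0r !normrN => fx gx.
by rewrite [e]splitr; apply: le_lt_trans (ler_normD _ _) _; exact: ltrD.
Qed.

Lemma self_joinable_add_ge : self_joinable alpha -> nbhs0_add_ge R alpha.
Proof.
move=> sj V /nbhs0_subbase_ballP[A [aA [e e0 AV]]].
have [G aG GA] := sj _ aA.
exists (subbase_ball G (e / 2)).
  by apply: subbase_ball_nbhs => //; rewrite divr_gt0.
by move=> _ [f Gf [g Gg <-]]; apply/AV/(subbase_ballD _ _ _ _ _ aA GA).
Qed.

(** Every element [U] of [G] contains the points where some nonnegative function
    in [subbase_ball G e] is less than [1], whatever [e]: a function separating the
    complement of [U] vanishes on an element of [G]. *)
Lemma subbase_ball_separating G (U : set X) (e : R) :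
  completely_regular_space X -> alpha G -> G U -> 0 < e ->
  exists f, [/\ subbase_ball G e f, forall x, 0 <= (f : continuousType X R) x
    & forall x, (f : continuousType X R) x < 1 -> U x].
Proof.
move=> creg aG GU e0; have cG := alpha_compact _ aG.
have [V GV [_ [h [hc h0 hV hU]]]] :=
  compact_family_separated R _ _ creg cG GU.
exists (mkcts hc : continuousType X R); split=> //.
- apply: (compact_familyS _ _ _ cG _ _ GV).
    by apply: Calpha_preimage_open; exact: ball_open.
  move=> x Vx; rewrite /= /mkcts hV//; exact: ballxx.
- move=> x; rewrite /= /mkcts => hx; apply: contrapT => /hU.
  by rewrite leNgt hx.
Qed.

Lemma add_ge_self_joinable :
  completely_regular_space X -> nbhs0_add_ge R alpha -> self_joinable alpha.
Proof.
move=> creg addV A aA.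
have [W /nbhs0_subbase_ballP[G [aG [e e0 GW]]] WA] :=
  addV _ (subbase_ball_nbhs _ _ aA (@ltr01 R)).
exists G => // _ [U GU [V GV <-]].
have [f [Gf f0 fU]] := subbase_ball_separating _ _ _ creg aG GU e0.
have [g [Gg g0 gV]] := subbase_ball_separating _ _ _ creg aG GV e0.
have Afg : subbase_ball A 1 (f + g).
  by apply: WA; exists f; [exact: GW|exists g; [exact: GW|]].
have [_ Gop _ _] := alpha_compact _ aG.
apply: (compact_familyS _ _ _ (alpha_compact _ aA) _ _ Afg).
  by apply: openI; exact: Gop.
(* f + g is less than 1, hence so are both nonnegative summands *)
move=> x; rewrite /= -ball_normE /= sub0r normrN => /(le_lt_trans (ler_norm _)).
move: (f0 x) (g0 x) => fx gx fgx.
by split; [apply: fU|apply: gV]; apply: le_lt_trans fgx; rewrite ?lerDl ?lerDr.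
Qed.

End NeighborhoodsOfZero.

Lemma nbhs0_add_ge_continuous (R : realType) (X : topologicalType)
    (alpha : set (set (set X))) :
  nbhs0_add_ge R alpha <->
  {for ((0 : Calpha R alpha), (0 : Calpha R alpha)),
     continuous (@Calpha_add X R alpha)}.
Proof.
have add00 : Calpha_add ((0 : Calpha R alpha), 0) = 0 by exact: addr0.
split=> [addV V|addC V V0].
  rewrite /= add00 => /addV[W W0 WV].
  exists (W, W) => // -[f g] [Wf Wg].
  by apply: WV; exists f => //; exists g.
have [|[W1 W2] [W10 W20] WV] := addC V; first by rewrite add00.
exists (W1 `&` W2); first exact: filterI.
by move=> _ [f [W1f _] [g [_ W2g] <-]]; exact: (WV (f, g)).
Qed.

Theorem theorem3p1 (R : realType) (X : topologicalType)
    (alpha : set (set (set X)))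
    (X_creg : completely_regular_space X)
    (alpha_compact : alpha `<=` compact_family)
    (alpha_setI : setI_closed alpha)
    (alpha_cover : forall U : set X, open U -> exists2 A, alpha A & A U) :
  (self_joinable alpha <-> nbhs0_add_ge R alpha) /\
  (nbhs0_add_ge R alpha <->
   {for ((0 : Calpha R alpha), (0 : Calpha R alpha)),
     continuous (@Calpha_add X R alpha)}).
Proof.
have alpha0 : alpha !=set0.
  by have [A aA _] := alpha_cover _ openT; exists A.
split; last exact: nbhs0_add_ge_continuous.
split; first exact: self_joinable_add_ge.
exact: add_ge_self_joinable.
Qed.
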